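(* (a) For every cardinal $\kappa\le\mathfrak{c}$ there is a separable metrizable space $M=M(\kappa)$ such that $\mathbf{seq}(M)=_T P(\kappa)\times(\kappa,=)$. (b) For every cardinal $\kappa\le\mathfrak{c}$ of countable cofinality, every cardinal $\lambda<\kappa$ and every $\mu\in\omega+1$ (i.e. $\mu\le\omega$) there is a separable metrizable space $N=N(\kappa,\lambda,\mu)$ such that $\mathbf{seq}(N)=_T P(\kappa)\times(\lambda,=)+Q(\kappa)\times(\mu,=)+S(\kappa)$.
   Context: A relation is a triple $\mathbf{A}=(A_-,A_+,A)$ of sets $A_-,A_+$ and a binary predicate $xAy$ for $x\in A_-$, $y\in A_+$; $(A',A)$ abbreviates $(A',A',A)$. A (Tukey) morphism from $\mathbf{A}$ to $\mathbf{B}$ is a pair $(\psi_-,\phi_+)$ of functions $\psi_-:B_-\to A_-$, $\phi_+:A_+\to B_+$ such that $\psi_-(b)\,A\,a$ implies $b\,B\,\phi_+(a)$ for all $b\in B_-$, $a\in A_+$. Write $\mathbf{A}\ge_T\mathbf{B}$ if there is such a morphism, $\mathbf{A}=_T\mathbf{B}$ if $\mathbf{A}\ge_T\mathbf{B}$ and $\mathbf{B}\ge_T\mathbf{A}$. $\mathbf{A}\times\mathbf{B}=(A_-\times B_-,A_+\times B_+,A\times B)$, predicate coordinatewise. The sum $\sum_{i}\mathbf{A}_i$ (binary: $\mathbf{A}+\mathbf{B}$) has as first and second entries the disjoint unions of the $(A_i)_-$ and of the $(A_i)_+$, with $x$ related to $y$ iff for some $i$, $x\in(A_i)_-$, $y\in(A_i)_+$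 and $xA_iy$. For a cardinal $\lambda$, $(\lambda,=)$ is equality on $\lambda$. For a space $X$: $\mathrm{NC}(X)$ is the set of non-closed subsets; $\mathrm{CS}^+(X)=\{e(\omega+1): e \text{ an embedding of the space }\omega+1\text{ into }X\}$ (infinite convergent sequences with limit); $S\,(\neg c)\,T$ means $S\cap T$ is not closed in $T$; $\mathbf{seq}(X)=(\mathrm{NC}(X),\mathrm{CS}^+(X),\neg c)$. For a sequence of cardinals $(\kappa_n)_n$, $\left(\prod_n[\kappa_n]^{<\omega}\right)_\infty$ is the set of sequences $(F_n)_{n\in\omega}$, $F_n$ a finite subset of $\kappa_n$, with $F_n\neq\emptyset$ for infinitely many $n$; $(F_n)_n\,i_\infty\,(G_n)_n$ means $F_n\cap G_n\neq\emptyset$ for infinitely many $n$. $P(\kappa)=\left((([\kappa]^{<\omega})^\omega)_\infty,i_\infty\right)$ (all $\kappa_n=\kappa$). For $\kappa$ with $\mathrm{cof}(\kappa)=\omega$, fix a strictly increasing sequence $(\kappa_n)_n$ of cardinals below $\kappa$ with supremum $\kappa$, and let $Q(\kappa)=\left(\left(\prod_n[\kappa_n]^{<\omega}\right)_\infty,i_\infty\right)$ and $S(\kappa)=\sum_n P(\kappa_n)\times(\kappa_n,=)$ (up to $=_T$ the choice of $(\kappa_n)_n$ does not matter). $\mathfrak{c}$ is the cardinality of the continuum. *)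

(* Defs.v *)
From mathcomp Require Import all_boot all_order all_algebra.
From mathcomp Require Import all_classical all_reals all_analysis.
From mathcomp Require wochoice.

Set Implicit Arguments.
Unset Strict Implicit.
Unset Printing Implicit Defensive.

Local Open Scope classical_set_scope.
Local Open Scope card_scope.

(* Cardinals are represented by types, compared through the library's [#<=];
   every notion below depends on such types only up to bijection (up to Tukey
   equivalence, for relations).  Finite cardinals, including 0, are allowed. *)

Definition card_lt (K L : Type) : Prop :=
  [set: K] #<= [set: L] /\ ~ ([set: L] #<= [set: K]).

(* [r] is a well order (non-strict, in the sense of [wochoice]) whose order
   type is the initial ordinal of the cardinality of [K]. *)
Definition initial_well_order (K : Type) (r : rel K) : Prop :=
  wochoice.well_order r /\
  forall x : K, ~ ([set: K] #<= [set y : K | r y x /\ y <> x]).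

Definition cofinal_set (K : Type) (r : rel K) (A : set K) : Prop :=
  forall x : K, exists2 y : K, A y & r x y.

(* cof(K) = C: the least cardinality of a cofinal subset of the initial
   ordinal K is that of C. *)
Definition has_cofinality (K C : Type) : Prop :=
  exists r : rel K,
    [/\ initial_well_order r,
        exists2 A : set K, cofinal_set r A & A #= [set: C] &
        forall A : set K, cofinal_set r A -> [set: C] #<= A].

Definition is_card_sup (kap : nat -> Type) (K : Type) : Prop :=
  (forall n : nat, [set: kap n] #<= [set: K]) /\
  forall L : Type,
    (forall n : nat, [set: kap n] #<= [set: L]) -> [set: K] #<= [set: L].

Record relation3 := Relation3 {
  neg_part : Type;
  pos_part : Type;
  rel3 : neg_part -> pos_part -> Prop
}.

Definition tukey_morphism (A B : relation3)
    (psi : neg_part B -> neg_part A) (phi : pos_part A -> pos_part B) : Prop :=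
  forall (b : neg_part B) (a : pos_part A),
    rel3 (psi b) a -> rel3 b (phi a).

Definition tukey_ge (A B : relation3) : Prop :=
  exists (psi : neg_part B -> neg_part A) (phi : pos_part A -> pos_part B),
    tukey_morphism psi phi.

Definition tukey_eq (A B : relation3) : Prop :=
  tukey_ge A B /\ tukey_ge B A.

Definition rel_prod (A B : relation3) : relation3 :=
  @Relation3 (neg_part A * neg_part B) (pos_part A * pos_part B)
    (fun x y => rel3 x.1 y.1 /\ rel3 x.2 y.2).

Definition rel_add (A B : relation3) : relation3 :=
  @Relation3 (neg_part A + neg_part B) (pos_part A + pos_part B)
    (fun x y => match x, y with
                | inl a, inl a' => rel3 a a'
                | inr b, inr b' => rel3 b b'
                | _, _ => False
                end).

Definition rel_sum (I : Type) (A : I -> relation3) : relation3 :=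
  @Relation3 {i : I & neg_part (A i)} {i : I & pos_part (A i)}
    (fun x y => exists (i : I) (a : neg_part (A i)) (a' : pos_part (A i)),
      [/\ x = existT _ i a, y = existT _ i a' & rel3 a a']).

Definition eq_rel (K : Type) : relation3 := @Relation3 K K (@eq K).

Definition fin_seqs_inf (kap : nat -> Type) : Type :=
  {F : forall n : nat, set (kap n) |
    (forall n : nat, finite_set (F n)) /\
    infinite_set [set n : nat | F n !=set0]}.

Definition inf_meet (kap : nat -> Type) (F G : fin_seqs_inf kap) : Prop :=
  infinite_set [set n : nat | sval F n `&` sval G n !=set0].

Definition Qrel (kap : nat -> Type) : relation3 :=
  @Relation3 (fin_seqs_inf kap) (fin_seqs_inf kap) (@inf_meet kap).

Definition Prel (K : Type) : relation3 := Qrel (fun _ : nat => K).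

Definition Srel (kap : nat -> Type) : relation3 :=
  rel_sum (fun n : nat => rel_prod (Prel (kap n)) (eq_rel (kap n))).

(* The ordinal space omega + 1: [nat] is discrete, [Some n] is the point n and
   [None] is the limit point omega. *)
Definition omega1 : topologicalType := one_point_compactification nat.

Definition embedding (X Y : topologicalType) (e : X -> Y) : Prop :=
  injective e /\
  forall U : set X, open U <-> exists2 V : set Y, open V & U = e @^-1` V.

Definition NC (X : topologicalType) : Type := {S : set X | ~ closed S}.

Definition CSplus (X : topologicalType) : Type :=
  {T : set X | exists2 e : omega1 -> X, embedding e & T = range e}.

(* [subspace T] carries the relative topology on T (the points outside T being
   isolated), so this says that S `&` T is closed in T; see
   [closed_subspaceP]. *)
Definition closed_in (X : topologicalType) (S T : set X) : Prop :=
  closed (S `&` T : set (subspace T)).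

Definition seq_rel (X : topologicalType) : relation3 :=
  @Relation3 (NC X) (CSplus X)
    (fun S T => ~ closed_in (sval S) (sval T)).

Definition separable_space (X : topologicalType) : Prop :=
  exists2 D : set X, countable D & dense D.

(* Main.v *)
Require Import Defs.
From HB Require Import structures.
From mathcomp Require Import all_boot all_order all_algebra.
From mathcomp Require Import all_classical all_reals all_analysis.
Import Order.TTheory GRing.Theory Num.Theory.

(** Around a point x of an ultrametric space, the punctured space is cut into
    annuli, the points at a given distance from x.  A sequence converging to x
    is a choice of a finite subset of each annulus, infinitely many of them
    nonempty, and two such sequences share infinitely many points iff they meet
    in infinitely many annuli.  A non-closed set contains a sequence that
    converges to a point x outside of it, and a convergent sequence with limit
    x detects the set as soon as it meets that sequence infinitely often.  So
    the sequence relation of the space is Tukey equivalent to the sum, over its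
    points x, of the relations Q of the annuli of x ([seq_rel_eq]).  A point
    whose annuli are eventually empty contributes nothing to the sum.

    The relation Q of a sequence of cardinals grows with the eventual values of
    these cardinals.  Hence two sums of such relations are equivalent as soon
    as each family of terms can be injected into the other without decreasing
    any of these cardinals eventually ([Qsum_eq]).  The right-hand sides of (a)
    and (b) are sums of this kind as well: the product with (lambda, =) is a sum
    of lambda copies, and in S(kappa) the n-th cardinal kappa_n yields kappa_n
    copies of P(kappa_n).

    It remains to build a separable space whose points have the right annuli.
    A set of points coded injectively by sequences over a countable alphabet
    carries the ultrametric of first difference, which is separable.  Let Y be
    the disjoint union of the kappa_n.  The points are: one limit point for
    each term of the sum, indexed by lambda + mu + Y; and, for each initial
    segment s of the code of a limit point, a block of points whose codes
    extend s by the code of an element of Y.  The block is chosen, as a function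
    of s, so that all annuli of a limit point but the first one contain a set of
    the prescribed size.  There are only countably many initial segments, so each
    kappa_j occurs in countably many blocks only, and a block point that comes
    from kappa_j has a neighbourhood inside its own copy of kappa_j.  If kappa_j
    is infinite, then omega * kappa_j = kappa_j ([infinite_absorbs_nat]), and
    all these points are absorbed by the kappa_j copies of P(kappa_j) in
    S(kappa); if kappa_j is finite they are isolated.  This gives
    [point_annuli_Qsum], from which (b) follows.  Part (a) is the case where
    lambda = mu = 0, kappa_0 = kappa and all other kappa_n are 0. *)

Set Implicit Arguments.
Unset Strict Implicit.
Unset Printing Implicit Defensive.

Local Open Scope classical_set_scope.
Local Open Scope card_scope.

(** * Cardinal arithmetic *)

Lemma card_leTP (A B : Type) :
  [set: A] #<= [set: B] <-> exists f : A -> B, injective f.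
Proof.
split=> [/card_leP[f]|[f finj]].
  pose g (a : A) : [set: A]%type := SigSub (mem_set (I : setT a)).
  exists (fun a => val (f (g a))) => a a' /val_inj.
  by move/(inj (mem_set I) (mem_set I))/(congr1 val).
have [g] : $|{injfun [set: A] >-> [set: B]}|.
  by apply/injfunPex; exists f => // x y _ _; exact: finj.
exact: inj_card_le g.
Qed.

(** Zorn's lemma gives a maximal partial injection [nat * A -> A] with [A]
    included in [K].  What is left of [K] is finite, since a countably infinite
    set disjoint from [A] could be added, and a finite rest can be sent into
    the copies of a single point of [A]. *)
Lemma infinite_absorbs_nat (K : Type) :
  infinite_set [set: K] -> exists f : nat * K -> K, injective f.
Proof.
move=> Kinf.
pose dom (G : set (nat * K * K)) := [set x | exists n y, G (n, x, y)].
pose P (G : set (nat * K * K)) :=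
  [/\ forall p y y', G (p, y) -> G (p, y') -> y = y',
      forall p p' y, G (p, y) -> G (p', y) -> p = p',
      forall x n, dom G x -> exists y, G (n, x, y) &
      forall p y, G (p, y) -> dom G y].
have [F FP Ftot|G [[Gfun Ginj Gtot Gran] Gmax]] := @Zorn_bigcup _ P.
  have join X Y : F X -> F Y -> exists2 Z, F Z & X `<=` Z /\ Y `<=` Z.
    move=> FX FY; have [XY|YX] := Ftot _ _ FX FY.
      by exists Y => //; split => //; exact: subset_refl.
    by exists X => //; split => //; exact: subset_refl.
  split.
  - move=> p y y' [X FX Xy] [Y FY Yy].
    have [Z FZ [XZ YZ]] := join _ _ FX FY.
    by have [h _ _ _] := FP _ FZ; exact: (h _ _ _ (XZ _ Xy) (YZ _ Yy)).
  - move=> p p' y [X FX Xy] [Y FY Yy].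
    have [Z FZ [XZ YZ]] := join _ _ FX FY.
    by have [_ h _ _] := FP _ FZ; exact: (h _ _ _ (XZ _ Xy) (YZ _ Yy)).
  - move=> x n [m [y [X FX Xy]]]; have [_ _ h _] := FP _ FX.
    by have [|z Xz] := h x n; [exists m, y|exists z, X].
  - move=> p y [X FX Xy]; have [_ _ _ h] := FP _ FX.
    by have [n [z Xz]] := h _ _ Xy; exists n, z, X.
have domCfin : finite_set (~` dom G).
  apply: contrapT => /infiniteP /card_leP [e0].
  have [e [einj eC]] : exists e : nat -> K, injective e /\ forall n, ~ dom G (e n).
    pose g (a : nat) : [set: nat]%type := SigSub (mem_set (I : setT a)).
    exists (fun a => val (e0 (g a))); split.
      move=> a b /val_inj.
      by move/(inj (mem_set I) (mem_set I))/(congr1 val).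
    by move=> n; exact: (set_valP (e0 (g n))).
  (* the injection on the new countable part is a pairing of indices *)
  pose H : set (nat * K * K) :=
    [set t | exists n m, t = (n, e m, e (pickle (n, m)))].
  have eN p y m : G (p, y) -> y <> e m.
    by move=> /Gran + ye; rewrite ye => /eC.
  have dN n x y m : G (n, x, y) -> x <> e m.
    by move=> Gy xe; apply: (eC m); rewrite -xe; exists n, y.
  have pinj n m n' m' : pickle (n, m) = pickle (n', m') :> nat -> n = n' /\ m = m'.
    by move/(pcan_inj pickleK) => [].
  apply: (Gmax (G `|` H)).
    split=> [|HG]; first by move=> ? ?; left.
    have /dN : G (0%N, e 0%N, e (pickle (0%N, 0%N))).
      by apply: HG; right; exists 0%N, 0%N.
    by apply.
  split.
  - move=> [n x] y y' [Gy|[a [b [-> -> ->]]]] [Gy'|[a' [b' h]]].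
    + exact: Gfun _ _ _ Gy Gy'.
    + by case: h Gy => -> -> _ /dN /(_ erefl).
    + by case: (dN _ _ _ b Gy').
    + by case: h => <- /einj -> ->.
  - move=> [n x] [n' x'] y [Gy|[a [b [-> -> h]]]] [Gy'|[a' [b' [-> -> h']]]].
    + exact: Ginj _ _ _ Gy Gy'.
    + by case: (eN _ _ _ Gy h').
    + by case: (eN _ _ _ Gy' h).
    + by move: h; rewrite h' => /einj /pinj[-> ->].
  - move=> x n [m [y [Gy|[a [b [_ -> _]]]]]].
      by have [|z Gz] := Gtot x n; [exists m, y|exists z; left].
    by exists (e (pickle (n, b))); right; exists n, b.
  - move=> p y [/Gran[n [z Gz]]|[n [m [_ ->]]]]; first by exists n, z; left.
    exists 0%N, (e (pickle (0%N, pickle (n, m)))); right.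
    by exists 0%N, (pickle (n, m)).
have [x0 Gx0] : dom G !=set0.
  apply/set0P/eqP => d0; apply: Kinf.
  by rewrite -setC0 -d0.
have [h hP] : {h : nat * K -> K | forall n x, dom G x -> G (n, x, h (n, x))}.
  apply/cid; have /choice[h hP] : forall p : nat * K, exists y, dom G p.2 -> G (p, y).
    move=> [n x]; have [/(Gtot x n)[y ?]|?] := pselect (dom G x); first by exists y.
    by exists x.
  by exists h => n x; exact: (hP (n, x)).
have hdom n x : dom G x -> dom G (h (n, x)) by move/(hP n)/Gran.
have hinj n n' x x' : dom G x -> dom G x' -> h (n, x) = h (n', x') ->
    n = n' /\ x = x'.
  by move=> dx dx' hh; have := Ginj _ _ _ (hP n x dx); rewrite hh;
     move=> /(_ _ (hP n' x' dx'))[].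
(* [r] numbers the finite rest of [K] *)
have [r rinj] : exists r : K -> nat, {in ~` dom G &, injective r}.
  by apply/countable_injP; exact: finite_set_countable.
pose f (p : nat * K) := if `[< dom G p.2 >] then h (pickle (0%N, p.1), p.2)
  else h (pickle ((r p.2).+1, p.1), x0).
exists f => -[n x] [n' x']; rewrite /f /=.
have pi (a b c d : nat) : pickle (a, b) = pickle (c, d) :> nat -> a = c /\ b = d.
  by move/(pcan_inj pickleK) => [].
case: asboolP => dx; case: asboolP => dx' /hinj.
- by case=> // /pi[_ ->] ->.
- by case=> // /pi[].
- by case=> // /pi[].
- case=> // /pi[[/rinj rr] ->] _; rewrite rr // inE; exact.
Qed.

Lemma infinite_absorbs_countable (W : countType) (K : Type) :
  infinite_set [set: K] -> exists f : W * K -> K, injective f.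
Proof.
move=> /infinite_absorbs_nat[f finj]; exists (fun p => f (pickle p.1, p.2)).
by move=> [w x] [w' x'] /finj [/(pcan_inj pickleK) -> ->].
Qed.

(** Proof irrelevance of [i = i] gives the injectivity for every index type. *)
Lemma existT_inj (I : Type) (A : I -> Type) (i : I) : injective (existT A i).
Proof.
move=> a b h; have := projT2_eq h.
by rewrite (Prop_irrelevance (projT1_eq h) erefl).
Qed.

(** * Tukey morphisms, products and sums *)

Lemma tukey_ge_trans (A B C : relation3) :
  tukey_ge A B -> tukey_ge B C -> tukey_ge A C.
Proof.
move=> [psi [phi AB]] [psi' [phi' BC]].
by exists (psi \o psi'), (phi' \o phi) => c a /AB /BC.
Qed.

Lemma tukey_eq_trans (A B C : relation3) :
  tukey_eq A B -> tukey_eq B C -> tukey_eq A C.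
Proof.
by move=> [AB BA] [BC CB]; split; [exact: tukey_ge_trans BC|exact: tukey_ge_trans BA].
Qed.

Lemma tukey_eq_sym (A B : relation3) : tukey_eq A B -> tukey_eq B A.
Proof. by case. Qed.

(** A default value serves for the elements [a] that are related to no
    [psi b], hence the first hypothesis. *)
Lemma tukey_ge_intro (A B : relation3) (psi : neg_part B -> neg_part A) :
  (pos_part A -> $|pos_part B|) ->
  (forall a, (exists b, rel3 (psi b) a) ->
    exists b', forall b, rel3 (psi b) a -> rel3 b b') ->
  tukey_ge A B.
Proof.
move=> inh H.
have /choice[phi phiP] : forall a, exists b', forall b, rel3 (psi b) a -> rel3 b b'.
  move=> a; have [/H//|no] := pselect (exists b, rel3 (psi b) a).
  have [b'] := inh a; exists b' => b ab.
  by case: no; exists b.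
by exists psi, phi => b a /phiP.
Qed.

Lemma rel_add_eq (A A' B B' : relation3) :
  tukey_eq A A' -> tukey_eq B B' -> tukey_eq (rel_add A B) (rel_add A' B').
Proof.
have ge (C C' D D' : relation3) :
    tukey_ge C C' -> tukey_ge D D' -> tukey_ge (rel_add C D) (rel_add C' D').
  move=> [psi [phi H]] [psi' [phi' H']].
  exists (fun x => match x with inl a => inl (psi a) | inr b => inr (psi' b) end).
  exists (fun x => match x with inl a => inl (phi a) | inr b => inr (phi' b) end).
  by move=> [b|b] [a|a] //=; [exact: H|exact: H'].
by move=> [AA' A'A] [BB' B'B]; split; exact: ge.
Qed.

Section Sums.

Variables (I : Type) (A : I -> relation3).

Lemma rel_sum_tag (x : neg_part (rel_sum A)) (y : pos_part (rel_sum A)) :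
  rel3 x y -> projT1 x = projT1 y.
Proof. by move=> [i [a [b [-> ->]]]]. Qed.

Lemma rel_sumE (i : I) (a : neg_part (A i)) (b : pos_part (A i)) :
  @rel3 (rel_sum A) (existT _ i a) (existT _ i b) <-> rel3 a b.
Proof.
split=> [[j [a' [b' [ea eb ab]]]]|ab]; last by exists i, a, b.
have eij := projT1_eq ea; simpl in eij; destruct eij.
have := projT2_eq ea; rewrite (Prop_irrelevance (projT1_eq ea) erefl) /= => ->.
by have := projT2_eq eb; rewrite (Prop_irrelevance (projT1_eq eb) erefl) /= => ->.
Qed.

End Sums.

(** The second coordinate of a product with an equality selects a copy of [A]. *)
Lemma rel_prod_eq_rel (A : relation3) (L : Type) :
  tukey_eq (rel_prod A (eq_rel L)) (rel_sum (fun _ : L => A)).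
Proof.
split.
  exists (fun x : {_ : L & _} => (projT2 x, projT1 x)).
  exists (fun y => existT (fun _ => pos_part A) y.2 y.1).
  by move=> [i a] [b j] [/= ab <-]; apply/(@rel_sumE L (fun=> A)).
exists (fun x => existT (fun _ => neg_part A) x.2 x.1).
exists (fun y : {_ : L & _} => (projT2 y, projT1 y)).
move=> [a i] [j b] /[dup] /rel_sum_tag /= ij; destruct ij.
by move/(@rel_sumE L (fun=> A)).
Qed.

Definition Qsum (I : Type) (k : I -> nat -> Type) : relation3 :=
  rel_sum (fun i => Qrel (k i)).

Lemma QsumE (I : Type) (k : I -> nat -> Type) (i : I) (F G : fin_seqs_inf (k i)) :
  @rel3 (Qsum k) (existT (fun i => fin_seqs_inf (k i)) i F)
    (existT (fun i => fin_seqs_inf (k i)) i G) <-> inf_meet F G.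
Proof. exact: (@rel_sumE I (fun i => Qrel (k i))). Qed.

(** The families are gathered before [Qrel] is applied, so that a sum of sums
    is again a [Qsum]. *)
Definition sum_fam (I J : Type) (k : I -> nat -> Type) (l : J -> nat -> Type)
  (x : I + J) : nat -> Type :=
  match x with inl i => k i | inr j => l j end.

Lemma rel_add_Qsum (I J : Type) (k : I -> nat -> Type) (l : J -> nat -> Type) :
  tukey_eq (rel_add (Qsum k) (Qsum l)) (Qsum (sum_fam k l)).
Proof.
pose Q x := fin_seqs_inf (sum_fam k l x).
pose f (x : {i & fin_seqs_inf (k i)} + {j & fin_seqs_inf (l j)}) : {x & Q x} :=
  match x with
  | inl (existT i F) => existT Q (inl i) F
  | inr (existT j F) => existT Q (inr j) F
  end.
pose g (x : {x & Q x}) : {i & fin_seqs_inf (k i)} + {j & fin_seqs_inf (l j)} :=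
  match x with
  | existT (inl i) F => inl (existT (fun i => fin_seqs_inf (k i)) i F)
  | existT (inr j) F => inr (existT (fun j => fin_seqs_inf (l j)) j F)
  end.
split; [exists g, f|exists f, g].
  move=> [[i|j] F] [[i' G]|[j' G]] //.
    move=> /[dup] /rel_sum_tag /= ii'; destruct ii' => /(@QsumE _ k) FG.
    exact/(@QsumE _ (sum_fam k l)).
  move=> /[dup] /rel_sum_tag /= ii'; destruct ii' => /(@QsumE _ l) FG.
  exact/(@QsumE _ (sum_fam k l)).
move=> [[i F]|[j F]] [[i'|j'] G] /[dup] /rel_sum_tag //=.
  move=> [ii']; destruct ii' => /(@QsumE _ (sum_fam k l)) FG.
  exact/(@QsumE _ k).
move=> [ii']; destruct ii' => /(@QsumE _ (sum_fam k l)) FG.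
exact/(@QsumE _ l).
Qed.

Lemma Srel_Qsum (kap : nat -> Type) :
  tukey_eq (Srel kap)
    (Qsum (fun (x : {n : nat & kap n}) (_ : nat) => kap (projT1 x))).
Proof.
pose B := fun x : {n : nat & kap n} => Prel (kap (projT1 x)).
pose A := fun n : nat => rel_prod (Prel (kap n)) (eq_rel (kap n)).
pose f (x : {n & fin_seqs_inf (fun _ => kap n) * kap n}%type) :
    {x : {n & kap n} & fin_seqs_inf (fun _ => kap (projT1 x))} :=
  match x with existT n (F, a) =>
    existT (fun x : {n & kap n} => fin_seqs_inf (fun _ => kap (projT1 x)))
      (existT kap n a) F end.
pose g (x : {x : {n & kap n} & fin_seqs_inf (fun _ => kap (projT1 x))}) :
    {n & fin_seqs_inf (fun _ => kap n) * kap n}%type :=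
  match x with existT (existT n a) F =>
    existT (fun n => fin_seqs_inf (fun _ => kap n) * kap n)%type n (F, a) end.
split; [exists g, f|exists f, g].
  move=> [[n a] F] [m [G b]] /[dup] /rel_sum_tag /= nm; destruct nm.
  by move=> /(@rel_sumE _ A) [/= FG <-]; apply/(@rel_sumE _ B).
move=> [n [F a]] [[m b] G] /[dup] /rel_sum_tag /= nm.
have nm' := projT1_eq nm; simpl in nm'; destruct nm'.
have := projT2_eq nm; rewrite (Prop_irrelevance (projT1_eq nm) erefl) /= => ab.
destruct ab => /(@rel_sumE _ B) FG.
by apply/(@rel_sumE _ A); split.
Qed.

(** This characterizes the sequences of cardinals for which Q has an element;
    the other terms of a sum are empty relations. *)
Definition substantial (k : nat -> Type) : Prop :=
  infinite_set [set n | $|k n|].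

Lemma fin_seqs_inf_substantial (k : nat -> Type) :
  fin_seqs_inf k -> substantial k.
Proof.
move=> [F [_ Finf]]; apply: sub_infinite_set Finf => n [x _] /=.
by squash x.
Qed.

(** Sending [x] to the set of its [r]-mates embeds the preimage into an image of [G]. *)
Lemma finite_injective_rel (A B : Type) (r : A -> B -> Prop) (G : set B) :
  (forall x x' y, r x y -> r x' y -> x = x') -> finite_set G ->
  finite_set [set x | exists2 y, G y & r x y].
Proof.
move=> rinj Gfin; pose s (y : B) := [set x | r x y].
have /sub_finite_set : [set x | exists2 y, G y & r x y] `<=`
    (@set1 A) @^-1` (s @` G).
  move=> x [y Gy rxy]; exists y => //; apply/seteqP; split=> [x' r'|x' ->//].
  exact: rinj r' rxy.
apply; apply: finite_preimage; last exact: finite_image.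
by move=> x y _ _ /seteqP[/(_ x erefl)].
Qed.

(** An injection that exists from rank [N] on only is encoded as a relation,
    because there may be no function at all below [N]. *)
Lemma eventually_le_rel (k l : nat -> Type) N :
  (forall n, (N <= n)%N -> [set: k n] #<= [set: l n]) ->
  exists r : forall n, k n -> l n -> Prop,
  [/\ forall n x y y', r n x y -> r n x y' -> y = y',
      forall n x x' y, r n x y -> r n x' y -> x = x' &
      forall n x, (N <= n)%N -> exists y, r n x y].
Proof.
move=> kl.
have H n : exists r : k n -> l n -> Prop,
    [/\ forall x y y', r x y -> r x y' -> y = y',
        forall x x' y, r x y -> r x' y -> x = x' &
        forall x, (N <= n)%N -> exists y, r x y].
  have [/kl/card_leTP[g ginj]|_] := leqP N n; last by exists (fun _ _ => False).
  exists (fun x y => y = g x); split=> [x y y' -> ->//|x x' y -> /ginj//|x _].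
  by exists (g x).
exists (fun n => sval (cid (H n))); split=> n.
- by move=> x y y'; have [+ _ _] := svalP (cid (H n)); apply.
- by move=> x x' y; have [_ + _] := svalP (cid (H n)); apply.
- by move=> x Nn; have [_ _ +] := svalP (cid (H n)); apply.
Qed.

(** A sequence of finite sets is carried along the injections of [k i] into
    [l (f i)], its first terms being lost; a sequence in [l (f i)] is pulled
    back to [k i].  Neither operation affects infinite meetings.  The first
    hypothesis excludes that the smaller sum is empty while the larger one is
    not, in which case there is no map between them. *)
Lemma Qsum_ge (I J : Type) (k : I -> nat -> Type) (l : J -> nat -> Type)
    (f : I -> J) :
  (pos_part (Qsum l) -> $|pos_part (Qsum k)|) ->
  (forall i i', substantial (k i) -> substantial (k i') -> f i = f i' -> i = i') ->
  (forall i, substantial (k i) ->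
    exists N, forall n, (N <= n)%N -> [set: k i n] #<= [set: l (f i) n]) ->
  tukey_ge (Qsum l) (Qsum k).
Proof.
move=> inh finj kl.
have H i : exists r : forall n, k i n -> l (f i) n -> Prop, substantial (k i) ->
  [/\ forall n x y y', r n x y -> r n x y' -> y = y',
      forall n x x' y, r n x y -> r n x' y -> x = x' &
      exists N, forall n x, (N <= n)%N -> exists y, r n x y].
  have [ki|ki] := pselect (substantial (k i)); last by exists (fun _ _ _ => False).
  by have [N /eventually_le_rel[r [r1 r2 r3]]] := kl i ki; exists r; split=> //; exists N.
pose r i := sval (cid (H i)).
have rP i : substantial (k i) ->
  [/\ forall n x y y', r i n x y -> r i n x y' -> y = y',
      forall n x x' y, r i n x y -> r i n x' y -> x = x' &
      exists N, forall n x, (N <= n)%N -> exists y, r i n x y].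
  exact: svalP (cid (H i)).
have imP i (F : fin_seqs_inf (k i)) :
  let F' n := [set y | exists2 x, sval F n x & r i n x y] in
  (forall n, finite_set (F' n)) /\ infinite_set [set n | F' n !=set0].
  have [rfun rinj [N rtot]] := rP i (fin_seqs_inf_substantial F).
  have [Ffin Finf] := svalP F; split.
    move=> n; apply: (@finite_injective_rel _ _ (fun y x => r i n x y)) (Ffin n).
    by move=> y y' x; exact: rfun.
  move=> fin; apply: Finf.
  apply: (@sub_finite_set _ _ (`I_N `|`
    [set n | [set y | exists2 x, sval F n x & r i n x y] !=set0])).
    move=> n [x Fx]; have [nN|Nn] := ltnP n N; first by left.
    by right; have [y rxy] := rtot n x Nn; exists y, x.
  by rewrite finite_setU; split => //; exact: finite_II.
pose psi (x : neg_part (Qsum k)) : neg_part (Qsum l) :=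
  existT (fun j => fin_seqs_inf (l j)) (f (projT1 x)) (exist _ _ (imP _ (projT2 x))).
apply: (@tukey_ge_intro _ _ psi) => // -[j G] [[i F]] /[dup] /rel_sum_tag /= ij.
destruct ij => /QsumE FG.
have si := fin_seqs_inf_substantial F; have [rfun rinj _] := rP i si.
pose G' n := [set x | exists2 y, sval G n y & r i n x y].
have meet (F0 : fin_seqs_inf (k i)) (FG0 : @inf_meet (l (f i)) (exist _ _ (imP i F0)) G) :
   infinite_set [set n | sval F0 n `&` G' n !=set0].
  apply: sub_infinite_set FG0 => n [y [/= [x Fx rxy] Gy]].
  by exists x; split=> //; exists y.
have G'P : (forall n, finite_set (G' n)) /\ infinite_set [set n | G' n !=set0].
  split; first by move=> n; apply: finite_injective_rel; [exact: rinj|have [] := svalP G].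
  by apply: sub_infinite_set (meet F FG) => n [x [_ ?]]; exists x.
exists (existT (fun i => fin_seqs_inf (k i)) i (exist _ G' G'P)) => -[i2 F2].
move=> /[dup] /(@rel_sum_tag _ (fun j => Qrel (l j))) /= ii2.
have {ii2} : i2 = i by apply: finj ii2 => //; exact: fin_seqs_inf_substantial F2.
move=> e; destruct e => /QsumE FG2; apply/QsumE.
exact: meet.
Qed.

Lemma substantial_le (k l : nat -> Type) : substantial k ->
  (exists N, forall n, (N <= n)%N -> [set: k n] #<= [set: l n]) -> substantial l.
Proof.
move=> kinf [N kl] linf; apply: kinf.
apply: (@sub_finite_set _ _ (`I_N `|` [set n | $|l n|])).
  move=> n [x]; have [nN|/kl/card_leTP[g _]] := ltnP n N; [by left|right].
  by squash (g x).
by rewrite finite_setU; split => //; exact: finite_II.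
Qed.

Lemma substantial_fin_seqs_inf (k : nat -> Type) :
  substantial k -> $|fin_seqs_inf k|.
Proof.
move=> kinf; have H n : exists F : set (k n), finite_set F /\ ($|k n| -> F !=set0).
  have [[x]|no] := pselect $|k n|; last by exists set0; split.
  by exists [set x]; split => [|_]; [exact: finite_set1|exists x].
pose F n := sval (cid (H n)); have FP n := svalP (cid (H n)).
suff FF : (forall n, finite_set (F n)) /\ infinite_set [set n | F n !=set0].
  by squash (exist _ F FF : fin_seqs_inf k).
split=> [n|]; first by case: (FP n).
by apply: sub_infinite_set kinf => n /(FP n).2.
Qed.

(** The two families of injections also transport inhabitants, which takes
    care of the empty cases. *)
Lemma Qsum_eq (I J : Type) (k : I -> nat -> Type) (l : J -> nat -> Type)
    (f : I -> J) (g : J -> I) :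
  (forall i i', substantial (k i) -> substantial (k i') -> f i = f i' -> i = i') ->
  (forall i, substantial (k i) ->
    exists N, forall n, (N <= n)%N -> [set: k i n] #<= [set: l (f i) n]) ->
  (forall j j', substantial (l j) -> substantial (l j') -> g j = g j' -> j = j') ->
  (forall j, substantial (l j) ->
    exists N, forall n, (N <= n)%N -> [set: l j n] #<= [set: k (g j) n]) ->
  tukey_eq (Qsum k) (Qsum l).
Proof.
move=> finj kl ginj lk; split.
  apply: (Qsum_ge (f := g)) => // -[i F].
  have ki := fin_seqs_inf_substantial F.
  have [G] := substantial_fin_seqs_inf (substantial_le ki (kl i ki)).
  by squash (existT (fun j => fin_seqs_inf (l j)) (f i) G).
apply: (Qsum_ge (f := f)) => // -[j F].
have lj := fin_seqs_inf_substantial F.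
have [G] := substantial_fin_seqs_inf (substantial_le lj (lk j lj)).
by squash (existT (fun i => fin_seqs_inf (k i)) (g j) G).
Qed.

(** * Spaces of coded points *)

Section Code.

Variables (T : Type) (C : countType) (code : T -> nat -> C).

Definition agree (n : nat) (x y : T) : Prop :=
  forall k, (k < n)%N -> code x k = code y k.

(** The sphere of radius [1 / n.+1] around [x], for the distance defined
    below. *)
Definition annulus (x : T) (n : nat) : set T :=
  [set y | agree n x y /\ code x n <> code y n].

Lemma agree_sym n x y : agree n x y -> agree n y x.
Proof. by move=> xy k kn; rewrite xy. Qed.

Lemma agree_trans n x y z : agree n x y -> agree n y z -> agree n x z.
Proof. by move=> xy yz k kn; rewrite xy // yz. Qed.

Lemma agree_le m n x y : (m <= n)%N -> agree n x y -> agree m x y.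
Proof. by move=> mn xy k km; apply: xy; exact: leq_trans mn. Qed.

Lemma annulus_inj x y m n : annulus x m y -> annulus x n y -> m = n.
Proof.
move=> [xym nm] [xyn nn]; have [mn|nm'|//] := ltngtP m n.
  by case: nm; exact: xyn.
by case: nn; exact: xym.
Qed.

Lemma annulus_agree x y m n : annulus x m y -> agree n x y -> (n <= m)%N.
Proof. by move=> [_ nm] xy; rewrite leqNgt; apply/negP => mn; apply/nm/xy. Qed.

Hypothesis code_inj : injective code.

Lemma annulus_exists x y : x <> y -> exists n, annulus x n y.
Proof.
move=> xy; have ex : exists n, code x n != code y n.
  apply: contrapT => no; apply: xy; apply: code_inj; apply/funext => n.
  by apply/eqP/negPn/negP => h; apply: no; exists n.
exists (ex_minn ex); case: ex_minnP => m /eqP hm mmin; split => // k km.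
by apply/eqP/negPn/negP => /mmin; rewrite leqNgt km.
Qed.

Variable R : realType.

Definition fdiff (x y : T) : nat := xget 0%N [set n | annulus x n y].

Lemma fdiffP x y : x <> y -> annulus x (fdiff x y) y.
Proof. by move=> /annulus_exists[n xny]; exact: (@xgetI _ 0%N [set n | annulus x n y] n). Qed.

Definition code_dist (x y : T) : R :=
  if `[< x = y >] then 0%R else ((fdiff x y).+1%:R^-1)%R.

Local Open Scope ring_scope.

Lemma code_distxx x : code_dist x x = 0.
Proof. by rewrite /code_dist; case: asboolP. Qed.

Lemma code_dist_neq x y n : annulus x n y -> code_dist x y = n.+1%:R^-1.
Proof.
move=> xny; rewrite /code_dist; case: asboolP => [xy|/fdiffP h].
  by case: xny => _; rewrite xy.
by rewrite (annulus_inj h xny).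
Qed.

Lemma code_dist_eq0 x y : code_dist x y = 0 -> x = y.
Proof.
rewrite /code_dist; case: asboolP => // _ /eqP.
by rewrite invr_eq0 pnatr_eq0.
Qed.

Lemma annulus_sym x y n : annulus x n y -> annulus y n x.
Proof. by move=> [/agree_sym xy nn]; split => // /esym. Qed.

Lemma code_dist_sym x y : code_dist x y = code_dist y x.
Proof.
have [->//|/annulus_exists[n xny]] := pselect (x = y).
by rewrite (code_dist_neq xny) (code_dist_neq (annulus_sym xny)).
Qed.

Lemma code_dist_lt x y n : code_dist x y < n.+1%:R^-1 <-> agree n.+1 x y.
Proof.
have [->|/annulus_exists[m xmy]] := pselect (x = y).
  by rewrite code_distxx; split => // _; rewrite invr_gt0 ltr0n.
rewrite (code_dist_neq xmy) ltf_pV2 ?posrE ?ltr0n // ltr_nat ltnS.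
split=> [nm|/(annulus_agree xmy)//].
by case: xmy => + _; apply: agree_le.
Qed.

Lemma code_dist_ge0 x y : 0 <= code_dist x y.
Proof. by rewrite /code_dist; case: asboolP => // _; rewrite invr_ge0. Qed.

Lemma code_dist_triangle y x z :
  code_dist x z <= code_dist x y + code_dist y z.
Proof.
have [->|/annulus_exists[m xmz]] := pselect (x = z).
  by rewrite code_distxx addr_ge0 ?code_dist_ge0.
rewrite leNgt; apply/negP; rewrite (code_dist_neq xmz) => lt.
have /code_dist_lt xy : code_dist x y < m.+1%:R^-1.
  by apply: le_lt_trans lt; rewrite lerDl code_dist_ge0.
have /code_dist_lt yz : code_dist y z < m.+1%:R^-1.
  by apply: le_lt_trans lt; rewrite lerDr code_dist_ge0.
by have := annulus_agree xmz (agree_trans xy yz); rewrite ltnn.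
Qed.

End Code.

(** The injectivity proof is an argument of the type so that the metric can be
    attached to it as a canonical structure. *)
Definition coded_space (R : realType) (T : Type) (C : countType)
  (code : T -> nat -> C) (code_inj : injective code) : Type := T.

Section CodedSpace.

Variables (R : realType) (T : Type) (C : countType).
Variables (code : T -> nat -> C) (code_inj : injective code).

Local Notation M := (coded_space R code_inj).

HB.instance Definition _ := gen_eqMixin M.
HB.instance Definition _ := gen_choiceMixin M.
HB.instance Definition _ := @isMetric.Build R M (@code_dist T C code R)
  (@code_distxx T C code R) (@code_dist_eq0 T C code R)
  (@code_dist_sym T C code code_inj R)
  (@code_dist_triangle T C code code_inj R).

Lemma coded_nbhsP (x : M) (A : set M) :
  nbhs x A <-> exists n, forall y, agree code n x y -> A y.
Proof.
rewrite -metricType_numDomainType.filter_from_mdist_nbhs; split.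
  move=> [e /= e0 xeA]; have [n en] : exists n, (n.+1%:R^-1 < e)%R.
    exists (Num.truncn e^-1); rewrite -[ltRHS]invrK ltf_pV2 ?posrE ?invr_gt0 ?ltr0n //.
    exact: truncnS_gt.
  by exists n.+1 => y /(code_dist_lt code_inj R) xy; apply: xeA; exact: lt_trans en.
move=> [n xnA]; exists (n.+1%:R^-1)%R; first by rewrite /= invr_gt0 ltr0n.
move=> y /(code_dist_lt code_inj R) xy; apply: xnA.
exact: agree_le xy.
Qed.

Lemma coded_openP (A : set M) :
  open A <-> forall x, A x -> exists n, forall y, agree code n x y -> A y.
Proof.
by rewrite openE; split=> h x /h /coded_nbhsP.
Qed.

Lemma coded_closedP (A : set M) :
  closed A <-> forall x, ~ A x -> exists n, forall y, A y -> ~ agree code n x y.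
Proof.
rewrite -openC coded_openP; split=> h x /h[n hn]; exists n => y.
  by move=> Ay /hn.
by move=> xy Ay; exact: (hn y).
Qed.

(** One point is picked for each finite word that begins some code; there are
    countably many words. *)
Lemma coded_separable : separable_space M.
Proof.
have /choice[p pP] : forall s : seq C, exists o : option M,
    (exists x, mkseq (code x) (size s) = s) ->
    exists2 x, o = Some x & mkseq (code x) (size s) = s.
  move=> s; have [[x xs]|no] := pselect (exists x, mkseq (code x) (size s) = s).
    by exists (Some x) => _; exists x.
  by exists None.
exists [set x | exists s, p s = Some x].
  have : countable (range p) by exact: card_le_trans (card_image_le _ _) (countableP _).
  apply: sub_countable.
  rewrite -(card_le_eql (card_some (A := [set x | exists s, p s = Some x]))).
  by apply: subset_card_le => _ [x [s ps] <-]; exists s.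
move=> O [x Ox] /coded_openP /(_ x Ox)[n xnO].
have [|y py ys] := pP (mkseq (code x) n); first by exists x; rewrite size_mkseq.
exists y; split; last by exists (mkseq (code x) n).
apply: xnO => k kn; move: ys; rewrite size_mkseq => /(congr1 (nth (code x 0%N) ^~ k)).
by rewrite !nth_mkseq.
Qed.

End CodedSpace.

(** * Convergent sequences in a coded space *)

(** The cover by singletons has a finite subcover. *)
Lemma compact_nat_finite (W : set nat) : compact W -> finite_set W.
Proof.
rewrite compact_cover => /(_ nat W (fun n => [set n])).
case=> [n _|n Wn|D _ WD]; [exact: discrete_open|by exists n|].
apply: sub_finite_set WD _; apply: bigcup_finite; first exact: finite_fset.
by move=> n _; exact: finite_set1.
Qed.

Lemma omega1_openP (U : set omega1) :
  open U <-> (U None -> finite_set [set n | ~ U (Some n)]).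
Proof.
rewrite openE; split=> [h /h [W [/compact_nat_finite Wfin _] WU]|h [n|] Ux].
- apply: sub_finite_set Wfin => n Un; apply: contrapT => nW; apply: Un.
  by apply: WU; left; exists n.
- by rewrite /interior /nbhs /=; apply/principal_filterP.
- exists [set n | ~ U (Some n)].
    split; first exact: finite_compact (h Ux).
    exact: discrete_closed.
  by move=> z [[m /contrapT Um <-]|->].
Qed.

Section Sequences.

Variables (R : realType) (T : Type) (C : countType).
Variables (code : T -> nat -> C) (code_inj : injective code).

Local Notation M := (coded_space R code_inj).
Local Notation agree := (agree code).
Local Notation annulus := (annulus code).

(** Convergence of the unordered set [A] to [x], for [A] infinite: every
    neighbourhood of [x] contains all but finitely many elements of [A].  The
    point [x] may belong to [A]. *)
Definition converges_to (A : set T) (x : T) : Prop :=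
  forall n, finite_set (A `&` annulus x n).

Lemma converges_agree (A : set T) (x : T) n :
  converges_to A x -> finite_set [set y | A y /\ y <> x /\ ~ agree n x y].
Proof.
move=> Ax; apply: (@sub_finite_set _ _ (\bigcup_(m in `I_n) (A `&` annulus x m))).
  move=> y [Ay [/nesym /(annulus_exists code_inj)[m xmy] nxy]].
  exists m => //=; rewrite ltnNge; apply/negP => nm; apply: nxy.
  by case: xmy => + _; apply: agree_le.
by apply: bigcup_finite => [|m _]; [exact: finite_II|exact: Ax].
Qed.

(** If [B] is infinite, it contains [x], so a point [y] outside of [B] has a
    neighbourhood that is disjoint from a neighbourhood of [x] and hence
    contains finitely many points of [B] only; a smaller one avoids these. *)
Lemma converges_closed (A B : set T) (x : T) :
  converges_to A x -> B `<=` x |` A -> (finite_set B \/ B x) ->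
  closed (B : set M).
Proof.
move=> Ax BA Bx; apply/coded_closedP => y By.
have [m mP] : exists m, finite_set [set z | B z /\ agree m y z].
  case: Bx => [Bfin|Bx]; first by exists 0%N; apply: sub_finite_set Bfin => z [].
  have /(annulus_exists code_inj)[m xmy] : x <> y by move=> xy; rewrite -xy in By.
  exists m.+1.
  apply: (@sub_finite_set _ _
    ([set x] `|` [set z | A z /\ z <> x /\ ~ agree m.+1 x z])); last first.
    by rewrite finite_setU; split; [exact: finite_set1|exact: converges_agree].
  move=> z [/BA + yz]; have [->|zx] := pselect (z = x); first by left.
  case=> [//|Az]; right; split => //; split => // xz.
  by have := annulus_agree xmy (agree_trans xz (agree_sym yz)); rewrite ltnn.
pose N z := xget 0%N [set n | annulus y n z].
have /finite_seqP [s sE] : finite_set (N @` [set z | B z /\ agree m y z]).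
  exact: finite_image.
(* beyond the annuli of the finitely many remaining points *)
exists (maxn m (\max_(i <- s) i).+1) => z Bz yz.
have yz0 : y <> z by move=> yz0; rewrite yz0 in By.
have yNz : annulus y (N z) z.
  by apply: (@xgetPex _ 0%N [set n | annulus y n z]); exact: annulus_exists.
have Ns : N z \in s.
  have : [set` s] (N z) by rewrite -sE; exists z => //;
      split => //; apply: agree_le yz; exact: leq_maxl.
  by [].
have := annulus_agree yNz yz; rewrite geq_max => /andP[_].
by rewrite ltnNge (leq_bigmax_seq _ Ns).
Qed.

(** Neighbourhoods of the point at infinity are cofinite. *)
Lemma embedding_converges (e : omega1 -> M) : embedding e ->
  converges_to (range e) (e None).
Proof.
move=> [einj eopen] n.
have /eopen /omega1_openP /(_ (fun _ _ => erefl)) fin :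
    exists2 V : set M, open V & e @^-1` (agree n.+1 (e None)) = e @^-1` V.
  exists (agree n.+1 (e None)) => //; apply/coded_openP => y xy; exists n.+1 => z yz.
  exact: agree_trans xy yz.
apply: sub_finite_set (finite_image (fun m => e (Some m)) fin).
move=> _ [[[m|] _ <-] [exy nn]]; last by [].
by exists m => //= h; apply: nn; exact: h.
Qed.

Lemma range_embedding_infinite (e : omega1 -> M) : embedding e ->
  infinite_set (range e).
Proof.
move=> [einj _] fin; apply: infinite_nat.
apply: sub_finite_set (finite_preimage (f := fun n => e (Some n)) _ fin).
  by move=> n _ /=; exists (Some n).
by move=> m n _ _ /einj [].
Qed.

(** [A] has finitely many points in each annulus, so it is countable and
    enumerated by [nat], and [x] is the image of the point at infinity.
    An open [U] is the preimage of the complement of the image of its own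
    complement: that image is finite or contains [x], hence is closed. *)
Lemma converges_embedding (A : set T) (x : T) :
  infinite_set A -> converges_to A x -> ~ A x ->
  exists2 e : omega1 -> M, embedding e & x |` A = range e.
Proof.
move=> Ainf Ax nAx.
have Acnt : countable A.
  have -> : A = \bigcup_n (A `&` annulus x n).
    apply/seteqP; split=> [y Ay|y [n _ []]//].
    have /(annulus_exists code_inj)[n xny] : x <> y by move=> xy; rewrite xy in nAx.
    by exists n.
  by apply: bigcup_countable => // n _; exact: finite_set_countable.
have /card_esym/card_bijP[f [g fK gK]] := eq_card_nat Acnt Ainf.
pose s n : T := val (f (SigSub (mem_set (I : [set: nat] n)))).
have sinj : injective s by move=> m n /val_inj /(can_inj fK) [].
have sA n : A (s n) by exact: set_valP.
have sS y : A y -> exists n, s n = y.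
  move=> Ay; exists (val (g (SigSub (mem_set Ay)))).
  rewrite /s (_ : SigSub _ = g (SigSub (mem_set Ay))) ?gK //.
  exact: val_inj.
pose e (o : omega1) : M := if o is Some n then s n else x.
have einj : injective e.
  move=> [m|] [n|] //= h; first by rewrite (sinj _ _ h).
    by case: nAx; rewrite -h.
  by case: nAx; rewrite h.
have eA o : (x |` A) (e o) by case: o => [n|]; [right; exact: sA|left].
exists e; last first.
  apply/seteqP; split=> [y| _ [w _ <-]]; last exact: eA.
  case=> [->|/sS[n <-]]; first by exists None.
  by exists (Some n).
split=> // U; split=> [/omega1_openP oU|[V oV ->]].
  exists (~` (e @` ~` U)).
    apply: closed_openC; apply: (converges_closed Ax) => [_ [w _ <-]//|].
    have [UN|nU] := pselect (U None); last by right; exists None.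
    left; apply: sub_finite_set (finite_image s (oU UN)) => _ [[n|] nUo <-].
      by exists n.
    by case: nUo.
  apply/seteqP; split=> o /=.
    by move=> Uo [w nUw /einj wo]; apply: nUw; rewrite wo.
  by move=> no; apply: contrapT => nU; apply: no; exists o.
apply/omega1_openP => Vx; move/coded_openP/(_ _ Vx) : oV => [n nV].
have fin := converges_agree n Ax.
apply: sub_finite_set (finite_preimage (f := s) _ fin); last first.
  by move=> p q _ _; exact: sinj.
move=> p np /=; split; first exact: sA.
split; first by move=> px; apply: nAx; rewrite -px.
by move=> xp; apply: np; apply: nV.
Qed.

End Sequences.

(** * The sequence relation as a sum over the points *)

Section SeqRel.

Variables (R : realType) (T : Type) (C : countType).
Variables (code : T -> nat -> C) (code_inj : injective code).

Local Notation M := (coded_space R code_inj).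
Local Notation agree := (agree code).
Local Notation annulus := (annulus code).

Definition annuli (x : T) (n : nat) : Type := set_type (annulus x n).

(** The convergent sequence, as a set of points, that corresponds to an element
    of the relation Q of the annuli of [x]. *)
Definition points_of (x : T) (F : fin_seqs_inf (annuli x)) : set T :=
  [set y | exists n, exists2 w, sval F n w & val w = y].

Lemma points_of_annulus x (F : fin_seqs_inf (annuli x)) n y :
  points_of F y -> annulus x n y -> exists2 w, sval F n w & val w = y.
Proof.
move=> [m [w Fw <-]] xnw; have := annulus_inj xnw (set_valP w).
by move=> nm; destruct nm; exists w.
Qed.

Lemma points_of_self x (F : fin_seqs_inf (annuli x)) : ~ points_of F x.
Proof. by move=> [n [w _ wx]]; case: (set_valP w) => _; rewrite wx. Qed.

Lemma points_of_converges x (F : fin_seqs_inf (annuli x)) :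
  converges_to code (points_of F) x.
Proof.
move=> n; have [Ffin _] := svalP F.
apply: sub_finite_set (finite_image (fun w => val w) (Ffin n)) => y [Fy xny].
by have [w Fw <-] := points_of_annulus Fy xny; exists w.
Qed.

Lemma converges_meet_infinite (A : set T) x :
  converges_to code A x ->
  infinite_set A -> infinite_set [set n | A `&` annulus x n !=set0].
Proof.
move=> Ax Ainf fin; apply: Ainf.
apply: (@sub_finite_set _ _ ([set x] `|`
   \bigcup_(n in [set n | A `&` annulus x n !=set0]) (A `&` annulus x n))).
  move=> y Ay; have [->|/nesym/(annulus_exists code_inj)[n xny]] := pselect (y = x).
    by left.
  by right; exists n => //; exists y.
by rewrite finite_setU; split; [exact: finite_set1|exact: bigcup_finite].
Qed.

Lemma annuli_meet_infinite (S : set T) x :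
  infinite_set [set n | S `&` annulus x n !=set0] -> infinite_set S.
Proof.
move=> inf Sfin; apply: inf.
pose N z := xget 0%N [set n | annulus x n z].
apply: sub_finite_set (finite_image N Sfin) => n [y [Sy xny]].
have xNy : annulus x (N y) y by exact: (@xgetI _ 0%N [set n | annulus x n y] n).
by exists y => //; exact: annulus_inj xNy xny.
Qed.

Lemma convergent_not_closed (S : set T) x :
  converges_to code S x -> infinite_set S -> ~ S x -> ~ closed (S : set M).
Proof.
move=> Sx Sinf nSx /coded_closedP/(_ _ nSx)[n nS]; apply: Sinf.
apply: sub_finite_set (converges_agree code_inj n Sx) => y Sy.
by split => //; split; [move=> yx; apply: nSx; rewrite -yx|exact: nS].
Qed.

Lemma CSplus_converges (A : CSplus M) : exists x : T,
  [/\ sval A x, converges_to code (sval A) x & infinite_set (sval A)].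
Proof.
case: A => A [e eemb Ae] /=; rewrite {}Ae; exists (e None); split.
- by exists None.
- exact: embedding_converges.
- exact: range_embedding_infinite.
Qed.

(** Conversely, a sequence that converges to [x] is cut into its finite
    intersections with the annuli of [x]. *)
Lemma annuli_restriction (A : set T) x : converges_to code A x -> infinite_set A ->
  let F n : set (annuli x n) := val @^-1` A in
  (forall n, finite_set (F n)) /\ infinite_set [set n | F n !=set0].
Proof.
move=> Ax Ainf F; split=> [n|].
  have : finite_set ((fun w : annuli x n => val w) @^-1` (A `&` annulus x n)).
    by apply: finite_preimage => // w w' _ _; exact: val_inj.
  by apply: sub_finite_set => w Fw; split => //; exact: set_valP.
apply: sub_infinite_set (converges_meet_infinite Ax Ainf) => n [y [Ay xny]].
by exists (SigSub (mem_set xny)).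
Qed.

(** From left to right, a sequence that converges to [y] is a non-closed set; if
    its trace on a convergent sequence [A] with limit [x] is not closed in [A],
    this trace is infinite and converges both to [x] and to [y], so [x = y].
    From right to left, a non-closed set [S] gives a sequence inside [S] with
    limit outside of [S]; a convergent sequence that meets it infinitely often
    contains its limit, so that its trace on [S] is not closed. *)
Lemma seq_rel_eq : tukey_eq (seq_rel M) (Qsum annuli).
Proof.
split.
  have ncl (p : neg_part (Qsum annuli)) : ~ closed (points_of (projT2 p) : set M).
    case: p => x F /=; apply: (convergent_not_closed (x := x)).
    - exact: points_of_converges.
    - apply: (@annuli_meet_infinite _ x); have [_] := svalP F.
      apply: sub_infinite_set => n [w Fw]; exists (val w); split; last exact: set_valP.
      by exists n, w.
    - exact: points_of_self.
  pose psi p : NC M := exist _ (points_of (projT2 p) : set M) (ncl p).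
  exists psi.
  suff /choice[phi phiP] : forall A : CSplus M, exists p : pos_part (Qsum annuli),
      forall b, @rel3 (seq_rel M) (psi b) A -> @rel3 (Qsum annuli) b p.
    by exists phi => b a; exact: phiP.
  move=> A; have [x [Ax Acvg Ainf]] := CSplus_converges A.
  exists (existT (fun x => fin_seqs_inf (annuli x)) x (exist _ _ (annuli_restriction Acvg Ainf))).
  move=> [y F] /= nclosed.
  have Binf : infinite_set (points_of F `&` sval A).
    move=> Bfin; apply: nclosed; apply/closed_subspaceP.
    exists (points_of F `&` sval A) => //.
    by apply: (converges_closed Acvg) => [z []|]; [right|left].
  have yx : y = x.
    apply: contrapT => /(annulus_exists code_inj)[n ynx]; apply: Binf.
    apply: sub_finite_set (_ : finite_set ([set x] `|`
       [set z | points_of F z /\ z <> y /\ ~ agree n.+1 y z] `|`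
       [set z | sval A z /\ z <> x /\ ~ agree n.+1 x z])).
      move=> z [Fz Az]; have [->|zx] := pselect (z = x); first by left; left.
      have [xz|nxz] := pselect (agree n.+1 x z); last by right.
      left; right; split=> //; split.
        by move=> zy; rewrite zy in Fz; exact: points_of_self Fz.
      by move=> yz; have := annulus_agree ynx (agree_trans yz (agree_sym xz)); rewrite ltnn.
    rewrite !finite_setU; split; first split.
    - exact: finite_set1.
    - exact: converges_agree (points_of_converges F).
    - exact: converges_agree Acvg.
  destruct yx; apply/QsumE.
  have BS : converges_to code (points_of F `&` sval A) y.
    by move=> n; apply: sub_finite_set (Acvg n) => z [[_ ?] ?].
  apply: sub_infinite_set (converges_meet_infinite BS Binf) => n [z [[Fz Az] yz]].
  by have [w Fw wz] := points_of_annulus Fz yz; exists w; split => //=; rewrite wz.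
have /choice[psi psiP] : forall S : NC M, exists p : neg_part (Qsum annuli),
    ~ sval S (projT1 p) /\ points_of (projT2 p) `<=` sval S.
  move=> [S ncS] /=.
  (* a point in the closure of [S] but not in [S] *)
  have [x [nSx xS]] : exists x, ~ S x /\ forall n, exists y, S y /\ agree n x y.
    apply: contrapT => no; apply: ncS; apply/coded_closedP => x nSx.
    apply: contrapT => no'; apply: no; exists x; split => // n.
    apply: contrapT => no''; apply: no'; exists n => y Sy xy; apply: no''.
    by exists y.
  have H n : exists F : set (annuli x n),
      [/\ finite_set F, forall w, F w -> S (val w) &
        (S `&` annulus x n !=set0 -> F !=set0)].
    have [[y [Sy xny]]|no] := pselect (S `&` annulus x n !=set0).
      exists [set SigSub (mem_set xny)]; split=> [|w ->//|_]; first exact: finite_set1.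
      by exists (SigSub (mem_set xny)).
    by exists set0; split.
  pose F n := sval (cid (H n)); have FP n := svalP (cid (H n)).
  have FF : (forall n, finite_set (F n)) /\ infinite_set [set n | F n !=set0].
    split=> [n|fin]; first by case: (FP n).
    have [m mP] : exists m, forall n, F n !=set0 -> (n < m)%N.
      have /finite_seqP[s sE] := fin.
      exists (\max_(i <- s) i).+1 => n Fn; rewrite ltnS.
      have : n \in s by have : [set` s] n by rewrite -sE.
      by move=> ns; exact: (leq_bigmax_seq _ ns).
    have [y [Sy xy]] := xS m.
    have /(annulus_exists code_inj)[n xny] : x <> y by move=> h; rewrite h in nSx.
    have [_ _ /(_ _)/mP nm] := FP n; have := annulus_agree xny xy.
    by rewrite leqNgt nm //; exists y.
  exists (existT (fun x => fin_seqs_inf (annuli x)) x (exist _ F FF)); split=> //.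
  by move=> y [n [w Fw <-]]; have [_ + _] := FP n; exact.
have /choice[phi phiP] : forall p : pos_part (Qsum annuli), exists A : CSplus M,
    sval A = projT1 p |` points_of (projT2 p).
  move=> [x F] /=; have [] := @converges_embedding R _ _ _ code_inj (points_of F) x.
  - apply: (@annuli_meet_infinite _ x); have [_] := svalP F.
    apply: sub_infinite_set => n [w Fw]; exists (val w); split; last exact: set_valP.
    by exists n, w.
  - exact: points_of_converges.
  - exact: points_of_self.
  by move=> e eemb eE; exists (exist _ _ (ex_intro2 _ _ e eemb eE)).
exists psi, phi => S [x G] /[dup] /rel_sum_tag /= Sx.
have [] := psiP S; have := phiP (existT _ x G).
case: (phi _) => /= A _ AE; subst A; case: (psi S) Sx => y F /= yx; destruct yx.
move=> nSy FS /QsumE FG; move=> /closed_subspaceP [V Vcl VE].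
pose B := points_of F `&` points_of G.
have Binf : infinite_set B.
  apply: (@annuli_meet_infinite _ y); apply: sub_infinite_set FG => n [w [Fw Gw]].
  by exists (val w); split; [split; exists n, w|exact: set_valP].
have Ay : (y |` points_of G) y by left.
have nVy : ~ V y.
  move=> Vy; have : (V `&` (y |` points_of G)) y by split.
  by rewrite VE => -[[/nSy]].
have /coded_closedP/(_ _ nVy)[n nV] := Vcl.
apply: Binf; apply: sub_finite_set (converges_agree code_inj n (points_of_converges G)).
move=> z [Fz Gz]; split => //; split.
  by move=> zy; move: Gz; rewrite zy; exact: points_of_self.
apply: nV; have : (sval S `&` (y |` points_of G) `&` (y |` points_of G)) z.
  by split; [split; [exact: FS|right]|right].
by rewrite -VE => -[].
Qed.

End SeqRel.

(** * A space with prescribed annuli *)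

Section Construction.

Variables (kap : nat -> Type) (L Mu : Type).

(** Its cardinality is the supremum of the [kap j] when these are increasing
    and the supremum is infinite. *)
Definition cells : Type := {j : nat & kap j}.

(** The terms of the right-hand side, one limit point for each: P(kappa) for
    [L], Q(kappa) for [Mu], P(kappa_j) for the elements of the cell [j]. *)
Definition limit_index : Type := (L + Mu + cells)%type.

Definition limit_fam : limit_index -> nat -> Type :=
  sum_fam (sum_fam (fun _ _ => cells) (fun _ n => kap n))
    (fun y _ => kap (projT1 y)).

Variables (eL : L -> nat -> nat) (eM : Mu -> nat).
Variable e : forall j, kap j -> nat -> nat.
Hypotheses (eL_inj : injective eL) (eM_inj : injective eM).
Hypothesis e_inj : forall j, injective (@e j).
(** In a finite cell the first letter separates the points.  Thus the limit
    points of a finite cell share no block with each other. *)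
Hypothesis e_fin : forall j, finite_set [set: kap j] ->
  injective (fun b : kap j => e b 0%N).

(** The three summands keep the three kinds of limit points at distance 1 from
    one another; so do the numbers of different cells. *)
Definition letter : countType := (nat + nat + nat * nat)%type.

(** The constant code of [m : Mu] isolates the corresponding limit point from
    all other ones, as its annuli should have exactly the sizes [kap n]. *)
Definition icode (i : limit_index) (k : nat) : letter :=
  match i with
  | inl (inl l) => inl (inl (eL l k))
  | inl (inr m) => inl (inr (eM m))
  | inr (existT j b) => inr (j, e b k)
  end.

(** The number of the cell is repeated in every letter, in particular in the
    first one: in a block, different cells are separated at once. *)
Definition cell_code (y : cells) (k : nat) : nat * nat :=
  (projT1 y, e (projT2 y) k).

(** Which cells enter the [n]-th annulus of the limit points whose code begins
    with [x]: all of them for [L], the [n]-th one for [Mu], the cell of the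
    limit point itself in the last case. *)
Definition allowed (x : letter) (n j : nat) : Prop :=
  match x with
  | inl (inl _) => True
  | inl (inr _) => j = n
  | inr (j', _) => j = j'
  end.

(** The letters of [u] up to rank [n] included, as a sequence that is constant
    from [n] on: the canonical form of an initial segment. *)
Definition freeze (n : nat) (u : nat -> letter) (k : nat) : letter :=
  u (minn k n).

(** Besides the limit points, a triple [(u, n, y)] stands for the point of the
    block over the word [u 0 ... u n] that corresponds to [y].  Only initial
    segments of codes of limit points bear a block; otherwise the limit points
    of [Mu] could have too large annuli. *)
Definition valid (t : limit_index + (nat -> letter) * nat * cells) : Prop :=
  match t with
  | inl _ => True
  | inr (u, n, y) =>
      allowed (u 0%N) n.+1 (projT1 y) /\ exists i, u = freeze n (icode i)
  end.

Definition point : Type := {t | valid t}.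

(** The codes of limit points and of cells use different letters, so the place
    where a code changes alphabet tells the length of the initial segment. *)
Definition point_code (t : point) (k : nat) : (letter + nat * nat)%type :=
  match sval t with
  | inl i => inl (icode i k)
  | inr (u, n, y) => if (k <= n)%N then inl (u k) else inr (cell_code y (k - n.+1))
  end.

Lemma point_eq (t t' : point) : sval t = sval t' -> t = t'.
Proof. by case: t t' => t tP [t' tP'] /= tt'; exact: eq_exist. Qed.

Lemma icode_inj : injective icode.
Proof.
move=> i i' ii'; have := congr1 (@^~ 0%N) ii'; have ii k := congr1 (@^~ k) ii'.
case: i i' ii {ii'} => [[l|m]|[j b]] [[l'|m']|[j' b']] ii //=.
- move=> _; congr (inl (inl _)); apply: eL_inj; apply/funext => k.
  by have [] := ii k.
- by move=> [/eM_inj ->].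
- move=> [jj' _]; destruct jj'; congr (inr (existT _ _ _)).
  by apply: e_inj; apply/funext => k; have [] := ii k.
Qed.

Lemma freeze_eq n (u v : nat -> letter) i i' :
  u = freeze n (icode i) -> v = freeze n (icode i') ->
  (forall k, (k <= n)%N -> u k = v k) -> u = v.
Proof.
move=> -> -> uv; apply/funext => k; have := uv (minn k n) (geq_minr _ _).
by rewrite /freeze -minnA minnn.
Qed.

Lemma point_code_inj : injective point_code.
Proof.
move=> [t tP] [t' tP'] tt'; apply: point_eq => /=.
have {tt'} h k : point_code (exist _ t tP) k = point_code (exist _ t' tP') k by rewrite tt'.
case: t tP h => [i|[[u n] y]] tP; case: t' tP' => [i'|[[u' n'] y']] tP' h.
- congr inl; apply: icode_inj; apply/funext => k.
  by have := h k; rewrite /point_code /= => -[].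
- by have := h n'.+1; rewrite /point_code /= ltnn.
- by have := h n.+1; rewrite /point_code /= ltnn.
have nn' : n = n'.
  have [nn'|nn'|//] := ltngtP n n'.
    by have := h n.+1; rewrite /point_code /= ltnn nn'.
  by have := h n'.+1; rewrite /point_code /= ltnn nn'.
destruct nn'; have uu k : (k <= n)%N -> u k = u' k.
  by move=> kn; have := h k; rewrite /point_code /= kn => -[].
have yy k : cell_code y k = cell_code y' k.
  have := h (k + n.+1)%N; rewrite /point_code /= leqNgt leq_addl /= addnK.
  by case=> h1 h2; exact: (congr2 pair h1 h2).
congr (inr (_, _, _)).
  by case: tP tP' {h} => _ [i iE] [_ [i' iE']]; exact: (freeze_eq iE iE').
case: y y' yy {h tP tP'} => [j b] [j' b'] yy; have [jj' _] := yy 0%N.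
destruct jj'; congr existT; apply: e_inj; apply/funext => k.
by have [] := yy k.
Qed.

Local Notation annulus := (annulus point_code).
Local Notation annuli := (annuli point_code).
Local Notation agree := (agree point_code).

Definition limit (i : limit_index) : point := exist valid (inl i) I.

Lemma block_valid i n y :
  allowed (icode i 0%N) n.+1 (projT1 y) -> valid (inr (freeze n (icode i), n, y)).
Proof. by move=> h; split; [rewrite /freeze min0n|exists i]. Qed.

Definition block i n y h : point := exist valid _ (@block_valid i n y h).

Definition label (i : limit_index) (n : nat) : limit_fam i n -> cells :=
  match i with
  | inl (inl l) => id
  | inl (inr m) => existT kap n
  | inr y => existT kap (projT1 y)
  end.

Lemma label_inj i n : injective (@label i n).
Proof.
by case: i => [[l|m]|y] //=; exact: existT_inj.
Qed.

Lemma allowed_label i n y :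
  allowed (icode i 0%N) n (projT1 y) <-> exists b, @label i n b = y.
Proof.
case: i => [[l|m]|[j c]] /=; case: y => j' b /=; split.
- by move=> _; exists (existT _ j' b).
- by [].
- by move=> jn; destruct jn; exists b.
- by move=> [b' h]; have := projT1_eq h.
- by move=> jj; destruct jj; exists b.
- by move=> [b' h]; have := projT1_eq h.
Qed.

(** The block over the first [n.+1] letters of [i] lies in the annulus of rank
    [n.+1]: that is where its points leave the alphabet of limit points. *)
Lemma block_annulus i n y h : annulus (limit i) n.+1 (@block i n y h).
Proof.
split=> [k|]; rewrite /point_code /=; last by rewrite ltnn.
by rewrite ltnS => kn; rewrite kn /freeze (minn_idPl kn).
Qed.

Lemma limit_annuli_ge i n : [set: limit_fam i n.+1] #<= [set: annuli (limit i) n.+1].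
Proof.
apply/card_leTP.
have H b : allowed (icode i 0%N) n.+1 (projT1 (@label i n.+1 b)).
  by apply/allowed_label; exists b.
exists (fun b => SigSub (mem_set (block_annulus (H b)))) => b b'.
move/(congr1 val)/(congr1 sval) => /= -[yy]; exact: label_inj yy.
Qed.

(** When no other limit point has the same first letter as [i], an annulus of
    [i] is reduced to a single block. *)
Lemma isolated_annuli_le i n : (forall i', icode i' 0%N = icode i 0%N -> i' = i) ->
  [set: annuli (limit i) n.+1] #<= [set: limit_fam i n.+1].
Proof.
move=> iso.
have H (t : annuli (limit i) n.+1) : exists b : limit_fam i n.+1,
    sval (val t) = inr (freeze n (icode i), n, label b).
  case: t => -[t tP] /= /set_mem xt; have [xt0 xtn] := xt.
  have := xt0 0%N isT; rewrite /point_code /=.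
  case: t tP xt xt0 xtn => [i'|[[u m] y]] tP xt xt0 xtn /=.
    by move=> [/esym/iso ii']; case: xtn; rewrite ii'.
  case: (tP) => al [i' uE] [/esym]; rewrite {1}uE {1}/freeze min0n => /iso ii'.
  destruct ii'; subst u; move: al; rewrite {1}/freeze min0n => al.
  have xm : annulus (limit i') m.+1 (exist valid _ tP).
    have := block_annulus al; congr (annulus _ _ _); exact: point_eq.
  have [mn] := annulus_inj xm xt; destruct mn.
  by have [b bE] := (allowed_label _ _ _).1 al; exists b; rewrite bE.
apply/card_leTP; exists (fun t => sval (cid (H t))) => t t' tt'.
apply/val_inj/point_eq.
by rewrite (svalP (cid (H t))) (svalP (cid (H t'))) tt'.
Qed.

(** The cell element from which a point originates. *)
Definition home (t : point) : option cells :=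
  match sval t with
  | inl (inl _) => None
  | inl (inr y) => Some y
  | inr (u, n, y) => Some y
  end.

(** Together with [home], this identifies a point.  It takes its values in a
    countable type, which is why each cell occurs countably often. *)
Definition tag (t : point) : option (seq letter) :=
  match sval t with
  | inl _ => None
  | inr (u, n, _) => Some (mkseq u n.+1)
  end.

Lemma home_tag_inj t t' y :
  home t = Some y -> home t' = Some y -> tag t = tag t' -> t = t'.
Proof.
case: t => [[[[l|m]|z]|[[u n] z]] tP]; case: t' => [[[[l'|m']|z']|[[u' n'] z']] tP'] //.
  by rewrite /home /= => -[->] [->] _; exact: point_eq.
rewrite /home /tag /= => -[zy] [zy'] /Some_inj uu; apply: point_eq => /=; subst z z'.
have nn : n = n' by have := congr1 size uu; rewrite !size_mkseq => -[].
destruct nn; congr (inr (_, _, _)).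
case: tP tP' => _ [i iE] [_ [i' iE']]; apply: (freeze_eq iE iE') => k kn.
have := congr1 (nth (u 0%N) ^~ k) uu.
by rewrite !nth_mkseq.
Qed.

Definition in_cell (j : nat) (t : point) : Prop :=
  exists b : kap j, home t = Some (existT kap j b).

(** The first letter gives the number of the cell, and the blocks below such a
    letter contain only that cell. *)
Lemma limit_cell (y : cells) n t :
  annulus (limit (inr y)) n.+1 t -> in_cell (projT1 y) t.
Proof.
case: y => j b [/(_ 0%N isT) + _]; rewrite /point_code /=.
case: t => [[[[l|m]|[j' b']]|[[u n'] [j' b']]] tP] //= [].
  by move=> jj _; destruct jj; exists b'.
move=> uE; have [+ _] := (tP); rewrite -uE => /= jj; destruct jj; exists b'; exact: erefl.
Qed.

(** Close to a block point there are only points of the same block, by the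
    change of alphabet at rank [n.+1], and of the same cell, by the letter that
    follows. *)
Lemma block_cell u n y (tP : valid (inr (u, n, y))) m t' :
  annulus (exist _ _ tP) (n + m).+2 t' ->
  in_cell (projT1 y) t' /\ tag t' = Some (mkseq u n.+1).
Proof.
move=> [tt' _].
have {tt'} h k : (k <= n.+1)%N -> point_code (exist _ _ tP) k = point_code t' k.
  by move=> kn; apply: tt'; rewrite ltnS (leq_trans kn) // ltnS leq_addr.
case: t' h => [[i|[[u' n'] y']] tP'] h.
  by have := h n.+1 (leqnn _); rewrite /point_code /= ltnn.
have nn' : n = n'.
  have [nn'|nn'|//] := ltngtP n n'.
    by have := h n.+1 (leqnn _); rewrite /point_code /= ltnn nn'.
  by have := h n (leqnSn _); rewrite /point_code /= leqnn leqNgt nn'.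
destruct nn'; split.
  have := h n.+1 (leqnn _); rewrite /point_code /= ltnn => -[jj _].
  case: y y' tP tP' h jj => j b [j' b'] tP tP' h /= jj; destruct jj.
  by exists b'.
congr Some; apply/eq_in_map => k; rewrite mem_iota /= add0n ltnS => kn.
by have := h k (leqW kn); rewrite /point_code /= kn => -[].
Qed.

(** The annuli of large rank lie in one and the same finite set and are pairwise
    disjoint, so almost all of them are empty. *)
Lemma finite_block_isolated t u n y : finite_set [set: kap (projT1 y)] ->
  sval t = inr (u, n, y) -> ~ substantial (annuli t).
Proof.
move=> jfin tE tsub; case: t tE tsub => t tP /= tE; subst t => tsub.
pose S := [set t' | in_cell (projT1 y) t' /\ tag t' = Some (mkseq u n.+1)].
have Sfin : finite_set S.
  pose r t' (b : kap (projT1 y)) :=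
    home t' = Some (existT kap _ b) /\ tag t' = Some (mkseq u n.+1).
  have : finite_set [set t' | exists2 b, setT b & r t' b].
    apply: finite_injective_rel jfin => t1 t2 b [h1 g1] [h2 g2].
    by apply: home_tag_inj h1 h2 _; rewrite g1.
  by apply: sub_finite_set => t' [[b hb] ?]; exists b.
suff : infinite_set S by [].
apply: (@annuli_meet_infinite _ _ point_code S (exist _ _ tP)).
move=> fin; apply: tsub.
apply: (@sub_finite_set _ _ (`I_(n.+2) `|`
  [set m | S `&` annulus (exist _ _ tP) m !=set0])); last first.
  by rewrite finite_setU; split => //; exact: finite_II.
move=> m [t']; have [mn|nm] := ltnP m n.+2; [by left|right].
exists (val t'); have := set_valP t'; split => //.
by apply: (@block_cell _ _ _ tP (m - n.+2)); rewrite -!addSn subnKC.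
Qed.

(** For finite cells [h] ignores the first argument: it is injective on limit
    points, and the block points of these cells are isolated. *)
Lemma cell_absorb : exists h : forall j, option (seq letter) * kap j -> kap j,
  forall j, (infinite_set [set: kap j] -> injective (h j)) /\
    (finite_set [set: kap j] -> forall w b, h j (w, b) = b).
Proof.
have H j : exists h : option (seq letter) * kap j -> kap j,
    (infinite_set [set: kap j] -> injective h) /\
    (finite_set [set: kap j] -> forall w b, h (w, b) = b).
  have [fin|inf] := pselect (finite_set [set: kap j]).
    by exists snd; split.
  have [h hinj] := @infinite_absorbs_countable (option (seq letter)) _ inf.
  by exists h; split.
by exists (fun j => sval (cid (H j))) => j; exact: (svalP (cid (H j))).
Qed.

Hypothesis cells_big :
  L -> infinite_set [set: cells] /\ [set: L] #<= [set: cells].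

Lemma point_le_cells : L -> [set: point] #<= [set: cells].
Proof.
move=> /cells_big[Yinf /card_leTP[g ginj]].
have [y0 _] := infinite_setN0 Yinf.
have [h hinj] := @infinite_absorbs_countable (nat + option (seq letter))%type _ Yinf.
pose s (t : point) : (nat + option (seq letter)) * cells :=
  match sval t with
  | inl (inl (inl l)) => (inl 0%N, g l)
  | inl (inl (inr m)) => (inl (eM m).+1, y0)
  | inl (inr y) => (inr (tag t), y)
  | inr (_, _, y) => (inr (tag t), y)
  end.
have sh t y : home t = Some y -> s t = (inr (tag t), y).
  by case: t => -[[[l|m]|z]|[[u n] z]] tP // [<-].
have sN t : home t = None -> exists n y, s t = (inl n, y).
  case: t => -[[[l|m]|z]|[[u n] z]] tP // _; first by exists 0%N, (g l).
  by exists (eM m).+1, y0.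
apply/card_leTP; exists (h \o s); apply: inj_comp hinj _ => t t'.
case hE : (home t) => [y|]; case hE' : (home t') => [y'|].
- rewrite (sh _ _ hE) (sh _ _ hE') => -[tt' yy']; rewrite -yy' in hE'.
  exact: home_tag_inj hE hE' tt'.
- by rewrite (sh _ _ hE); have [n [y' ->]] := sN _ hE'.
- by rewrite (sh _ _ hE'); have [n [y ->]] := sN _ hE.
case: t hE => -[[[l|m]|z]|[[u n] z]] tP // _;
  case: t' hE' => -[[[l'|m']|z']|[[u' n'] z']] tP' // _; rewrite /s /=.
  by move=> -[/ginj ll']; apply: point_eq; rewrite /= ll'.
by move=> -[/eM_inj mm']; apply: point_eq; rewrite /= mm'.
Qed.

(** Each term of the right-hand side is bounded by its limit point.  In the other
    direction, a point of [L] or [Mu] is sent to its own term, and a point that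
    originates from the cell [j] to a term of the same cell, chosen injectively
    by [h] when the cell is infinite. *)
Lemma point_annuli_Qsum : tukey_eq (Qsum annuli) (Qsum limit_fam).
Proof.
apply: tukey_eq_sym; have [h hP] := cell_absorb.
pose F (t : point) : limit_index :=
  match sval t with
  | inl (inl x) => inl x
  | inl (inr y) => inr (existT kap (projT1 y) (h _ (tag t, projT2 y)))
  | inr (_, _, y) => inr (existT kap (projT1 y) (h _ (tag t, projT2 y)))
  end.
have Fh t y : home t = Some y ->
    F t = inr (existT kap (projT1 y) (h _ (tag t, projT2 y))).
  by case: t => -[[[l|m]|z]|[[u n] z]] tP // [<-].
have FN t : home t = None -> exists2 x, sval t = inl (inl x) & F t = inl x.
  by case: t => -[[x|z]|[[u n] z]] tP //; exists x.
have finite_tag t y : substantial (annuli t) -> home t = Some y ->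
    finite_set [set: kap (projT1 y)] -> tag t = None.
  case: (t) (@finite_block_isolated t) => -[[[l|m]|z]|[[u n] z]] tP // iso tsub.
  by move=> [<-] yfin; case: (iso u n z yfin erefl).
have cell_le t j N : in_cell j t -> infinite_set [set: kap j] ->
    (forall n t', (N <= n)%N -> annulus t n t' -> in_cell j t') ->
    forall n, (N <= n)%N -> [set: annuli t n] #<= [set: kap j].
  move=> tj jinf cellN n Nn; apply/card_leTP.
  have H (w : annuli t n) : in_cell j (val w) by apply: cellN Nn _; exact: set_valP.
  exists (fun w => h j (tag (val w), sval (cid (H w)))) => w w'.
  move=> /((hP j).1 jinf) [ww' bb']; apply/val_inj.
  apply: home_tag_inj (svalP (cid (H w))) _ ww'.
  by rewrite (svalP (cid (H w'))) bb'.
apply: (Qsum_eq (f := limit) (g := F)).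
- by move=> i i' _ _ /(congr1 sval) [].
- by move=> i _; exists 1%N => -[//|n] _; exact: limit_annuli_ge.
- move=> t t' tsub tsub'.
  case hE : (home t) => [y|]; case hE' : (home t') => [y'|].
  + rewrite (Fh _ _ hE) (Fh _ _ hE') => Feq.
    have {Feq} := inr_inj Feq.
    case: y y' hE hE' => j b [j' b'] hE hE' /= yy'.
    have /= jj' := projT1_eq yy'; destruct jj'; have hh := existT_inj yy'.
    have [jfin|jinf] := pselect (finite_set [set: kap j]).
      move: hh; rewrite !(hP j).2 // => bb'; rewrite -bb' in hE'.
      apply: (home_tag_inj hE hE').
      by rewrite (finite_tag _ _ tsub hE) // (finite_tag _ _ tsub' hE').
    have [tt' bb'] := (hP j).1 jinf _ _ hh; rewrite -bb' in hE'.
    exact: home_tag_inj hE hE' tt'.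
  + by rewrite (Fh _ _ hE); have [x _ ->] := FN _ hE'.
  + by rewrite (Fh _ _ hE'); have [x _ ->] := FN _ hE.
  have [x tx ->] := FN _ hE; have [x' tx' ->] := FN _ hE' => -[xx'].
  by apply: point_eq; rewrite tx tx' xx'.
- move=> t tsub.
  case hE : (home t) => [[j b]|]; last first.
    have [[l|m] tx Fx] := FN _ hE; rewrite Fx; last first.
      have -> : t = limit (inl (inr m)) by exact: point_eq.
      exists 1%N => -[//|n] _; apply: isolated_annuli_le => -[[l'|m']|[j b]] //=.
      by move=> [/eM_inj ->].
    exists 0%N => n _; apply: card_le_trans (point_le_cells l).
    by apply/card_leTP; exists val; exact: val_inj.
  rewrite (Fh _ _ hE) /=.
  have [jfin|jinf] := pselect (finite_set [set: kap j]).
    have tagN := finite_tag _ _ tsub hE jfin.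
    have -> : t = limit (inr (existT kap j b)).
      by apply: (home_tag_inj hE) => //; rewrite tagN.
    exists 1%N => -[//|n] _.
    apply: (@isolated_annuli_le (inr (existT kap j b))) => -[[l'|m']|[j' b']] //=.
    by move=> [jj']; destruct jj' => /(e_fin jfin) ->.
  have tj : in_cell j t by exists b.
  have [N cellN] : exists N, forall n t', (N <= n)%N -> annulus t n t' -> in_cell j t'.
    case: (t) hE => -[[[l|m]|z]|[[u n] z]] tP // [zE].
      exists 1%N => -[//|n] t' _ tt'; have -> : j = projT1 z by rewrite zE.
      by apply: (@limit_cell z n); congr (annulus _ _ _): tt'; exact: point_eq.
    exists n.+2 => k t' nk tt'; have -> : j = projT1 z by rewrite zE.
    apply: (@block_cell u n z tP (k - n.+2) t' _).1.
    by rewrite -!addSn subnKC.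
  by exists N; exact: cell_le tj jinf cellN.
Qed.

End Construction.

(** * Realization over the reals *)

(** A real number is coded by the rational numbers below it. *)
Lemma real_code (R : realType) : exists c : R -> nat -> nat, injective c.
Proof.
pose c (x : R) (n : nat) : nat := if unpickle n is Some q then (ratr q < x)%R else false.
have lt_neq (x y : R) : (x < y)%R -> c x <> c y.
  move=> /rat_in_itvoo[q]; rewrite in_itv /= => /andP[xq qy].
  move=> /(congr1 (@^~ (pickle q))); rewrite /c pickleK qy.
  by rewrite ltNge (ltW xq).
exists c => x y cxy; have [xy|yx|//] := ltgtP x y; first by case: (lt_neq _ _ xy).
by case: (lt_neq _ _ yx).
Qed.

Lemma code_le_real (R : realType) (K : Type) :
  [set: K] #<= [set: R] -> exists c : K -> nat -> nat, injective c.
Proof.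
move=> /card_leTP[f finj]; have [c cinj] := real_code R.
by exists (c \o f); exact: inj_comp.
Qed.

(** A finite cell is countable, so a constant sequence can code each of its elements. *)
Lemma code_finite_separated (R : realType) (K : Type) :
  [set: K] #<= [set: R] -> exists c : K -> nat -> nat,
    injective c /\ (finite_set [set: K] -> injective (fun b => c b 0%N)).
Proof.
move=> KR; have [Kfin|Kinf] := pselect (finite_set [set: K]).
  have /card_leTP[f finj] : [set: K] #<= [set: nat] by exact: finite_set_countable.
  exists (fun b _ => f b); split=> [b b' /(congr1 (@^~ 0%N))|_ b b'] /=; exact: finj.
by have [c cinj] := code_le_real KR; exists c; split.
Qed.

(** The last hypothesis ensures that all points together are as few as the
    elements of [cells], which bounds the annuli of the limit points of [L]. *)
Lemma Qsum_realized (R : realType) (kap : nat -> Type) (L Mu : Type) :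
  (forall j, [set: kap j] #<= [set: R]) -> [set: L] #<= [set: R] ->
  [set: Mu] #<= [set: nat] ->
  (L -> infinite_set [set: cells kap] /\ [set: L] #<= [set: cells kap]) ->
  exists N : metricType R,
    separable_space N /\ tukey_eq (seq_rel N) (Qsum (@limit_fam kap L Mu)).
Proof.
move=> kapR LR /card_leTP[eM eM_inj] Lbig; have [eL eL_inj] := code_le_real LR.
pose e j := sval (cid (code_finite_separated (kapR j))).
have eP j := svalP (cid (code_finite_separated (kapR j))).
have code_inj := point_code_inj (e := e) eL_inj eM_inj (fun j => (eP j).1).
exists (coded_space R code_inj); split; first exact: coded_separable.
apply: tukey_eq_trans (seq_rel_eq R code_inj) _.
by apply: point_annuli_Qsum => // j; exact: (eP j).2.
Qed.

Theorem theorem4p11 (R : realType) :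
  (forall K : Type, [set: K] #<= [set: R] ->
     exists M : metricType R,
       separable_space M /\
       tukey_eq (seq_rel M) (rel_prod (Prel K) (eq_rel K))) /\
  (forall (K : Type) (kap : nat -> Type) (L Mu : Type),
     [set: K] #<= [set: R] ->
     has_cofinality K nat ->
     (forall m n : nat, (m < n)%N -> card_lt (kap m) (kap n)) ->
     (forall n : nat, card_lt (kap n) K) ->
     is_card_sup kap K ->
     card_lt L K ->
     [set: Mu] #<= [set: nat] ->
     exists N : metricType R,
       separable_space N /\
       tukey_eq (seq_rel N)
         (rel_add
            (rel_add (rel_prod (Prel K) (eq_rel L))
                     (rel_prod (Qrel kap) (eq_rel Mu)))
            (Srel kap))).
Proof.
split=> [K KR|K kap L Mu KR [r [_ [A _ Anat] _]] _ kapK [_ Ksup] [LK _] Munat].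
  (* the sums over [L] and [Mu] are empty, and [K] is the only nonempty cell *)
  pose kap (n : nat) : Type := if n is 0%N then K else False.
  have le0 (U : Type) : [set: False] #<= [set: U] by apply/card_leTP; exists (False_rect U).
  have [|||[]|M [Msep Meq]] := @Qsum_realized R kap False False.
  - by case.
  - exact: le0.
  - exact: le0.
  exists M; split => //; apply: tukey_eq_trans Meq _.
  apply: tukey_eq_trans (tukey_eq_sym (rel_prod_eq_rel (Prel K) K)).
  have iE (i : limit_index kap False False) : exists b : K, i = inr (existT kap 0%N b).
    by case: i => [[[]|[]]|[[|j] b]]; [exists b|case: b].
  pose f i := sval (cid (iE i)).
  have fE i : i = inr (existT kap 0%N (f i)) by exact: svalP (cid (iE i)).
  apply: (@Qsum_eq _ _ _ _ f (fun b => inr (existT kap 0%N b))).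
  - by move=> i i' _ _ ff; rewrite (fE i) (fE i') ff.
  - by move=> i _; exists 0%N => n _; rewrite (fE i).
  - by move=> b b' _ _ bb'; exact: (existT_inj (inr_inj bb')).
  - by move=> b _; exists 0%N.
have Kinf : infinite_set [set: K].
  apply/infiniteP; apply: card_le_trans (card_leT A).
  by move: Anat; rewrite card_eq_sym => /card_eqPle[].
(* omega * kappa = kappa, as the cofinality of [K] makes it infinite *)
have YK : [set: cells kap] #<= [set: K].
  have H n : exists g : kap n -> K, injective g by apply/card_leTP; exact: (kapK n).1.
  have [h hinj] := infinite_absorbs_nat Kinf.
  apply/card_leTP; exists (fun y => h (projT1 y, sval (cid (H _)) (projT2 y))).
  move=> [j b] [j' b'] /hinj /= [jj']; destruct jj' => /(svalP (cid (H j))) -> //.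
have KY : [set: K] #<= [set: cells kap].
  by apply: Ksup => n; apply/card_leTP; exists (existT kap n); exact: existT_inj.
have [||||N [Nsep Neq]] := @Qsum_realized R kap L Mu.
- by move=> j; exact: card_le_trans (kapK j).1 KR.
- exact: card_le_trans LK KR.
- by [].
- move=> _; split; last exact: card_le_trans LK KY.
  by apply/infiniteP; apply: card_le_trans KY; exact/infiniteP.
exists N; split => //; apply: tukey_eq_trans Neq _.
apply: tukey_eq_sym; apply: tukey_eq_trans.
  apply: rel_add_eq (Srel_Qsum kap); apply: tukey_eq_trans (rel_add_Qsum _ _).
  by apply: rel_add_eq; exact: rel_prod_eq_rel.
apply: tukey_eq_trans (rel_add_Qsum _ _) _.
apply: (@Qsum_eq _ _ _ _ id id) => // -[[l|m]|y] _; exists 0%N => n _ //=.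
Qed.
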